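(* A (finite) graph $G$ has diagonal Eulerian magnitude homology, i.e. the only nontrivial Eulerian magnitude homology groups $EMH_{k,\ell}(G)$ are those with $k=\ell$, if and only if $G$ is a complete graph.
   Context: Graphs are finite and undirected, with vertex set $V(G)$. $d(a,b)$ is the least number of edges in a walk from $a$ to $b$ ($\infty$ if none). A $k$-path is a tuple $(v_0,\dots,v_k)\in V(G)^{k+1}$ with $v_i\ne v_{i+1}$ and $d(v_i,v_{i+1})<\infty$ for $0\le i\le k-1$; its length is $\sum_{i=0}^{k-1}d(v_i,v_{i+1})$. It is Eulerian if its entries are pairwise distinct. $EMC_{k,\ell}(G)$ is the free abelian group on Eulerian $k$-paths of length $\ell$. The differential $\partial_{k,\ell}:EMC_{k,\ell}(G)\to EMC_{k-1,\ell}(G)$ is $\sum_{i=1}^{k-1}(-1)^i\partial^i_{k,\ell}$, where $\partial^i_{k,\ell}(v_0,\dots,v_k)$ is the tuple with $v_i$ deleted if that tuple still has length $\ell$, and $0$ otherwise. $EMH_{k,\ell}(G)=\ker\partial_{k,\ell}/\operatorname{im}\partial_{k+1,\ell}$.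
   Formalization: The graph G is additionally assumed connected (all distances finite); without this the claim fails, e.g. two isolated vertices have diagonal Eulerian magnitude homology but do not form a complete graph. *)

(* Defs.v *)
From HB Require Import structures.
From mathcomp Require Import all_boot all_order all_algebra.
From mathcomp Require Import boolp.

Set Implicit Arguments.
Unset Strict Implicit.
Unset Printing Implicit Defensive.

Import GRing.Theory.
Local Open Scope ring_scope.

(* A finite simple graph is a symmetric irreflexive relation e on a finType V. *)
Section EulerianMagnitudeHomology.
Variables (V : finType) (e : rel V).

Definition walk (n : nat) (x y : V) : bool :=
  [exists p : n.-tuple V, path e x p && (last x p == y)].

Lemma connect_walk (x y : V) : connect e x y -> exists n, walk n x y.
Proof.
case/connectP=> p ep ->; exists (size p); apply/existsP.
by exists (in_tuple p); rewrite ep eqxx.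
Qed.

(* None stands for an infinite distance. *)
Definition gdist (x y : V) : option nat :=
  if connect e x y =P true is ReflectT xy then
    Some (ex_minn (connect_walk xy))
  else None.

Lemma gdistP (x y : V) (n : nat) :
  gdist x y = Some n <-> walk n x y /\ (forall m, walk m x y -> (n <= m)%N).
Proof.
rewrite /gdist; case: eqP => [xy|nxy].
  case: ex_minnP => d wd dmin; split=> [[<-] //|[wn nmin]].
  by congr Some; apply/eqP; rewrite eqn_leq dmin // nmin.
split=> // -[/existsP[p /andP[ep /eqP lp]] _]; case: nxy.
by apply/connectP; exists (val p).
Qed.

Definition is_kpath (k : nat) (t : k.+1.-tuple V) : bool :=
  [forall i : 'I_k,
     let a := tnth t (widen_ord (leqnSn k) i) in
     let b := tnth t (lift ord0 i) in
     (a != b) && (gdist a b != None)].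

(* The default value of odflt is never used when t is a k-path. *)
Definition kpath_length (k : nat) (t : k.+1.-tuple V) : nat :=
  (\sum_(i < k)
     odflt 0 (gdist (tnth t (widen_ord (leqnSn k) i)) (tnth t (lift ord0 i))))%N.

Definition is_eulerian (k l : nat) (t : k.+1.-tuple V) : bool :=
  [&& is_kpath t, uniq t & kpath_length t == l].

Definition epath (k l : nat) : Type := {t : k.+1.-tuple V | is_eulerian l t}.
HB.instance Definition _ (k l : nat) := SubFinite.on (epath k l).

(* The free abelian group on the finite set of generators epath k l. *)
Definition EMC (k l : nat) : Type := {ffun epath k l -> int}.
HB.instance Definition _ (k l : nat) := GRing.Zmodule.on (EMC k l).

Definition EMC_gen (k l : nat) (t : epath k l) : EMC k l :=
  [ffun s => (s == t)%:R].

Definition del (k : nat) (i : 'I_k.+2) (t : k.+2.-tuple V) : k.+1.-tuple V :=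
  [tuple tnth t (lift i j) | j < k.+1].

(* Deleting an inner vertex of an Eulerian path always leaves an Eulerian path,
   so insub fails exactly when the length changes. *)
Definition face (k l : nat) (i : 'I_k.+2) (t : epath k.+1 l) : EMC k l :=
  if insub (del i (val t)) is Some s then EMC_gen (s : epath k l) else 0.

(* The differential EMC_{k+1,l} -> EMC_{k,l}, extended linearly. *)
Definition bdry (k l : nat) (c : EMC k.+1 l) : EMC k l :=
  \sum_(t : epath k.+1 l)
     (\sum_(i < k.+2 | (0 < i < k.+1)%N) face i t *~ ((-1) ^+ i)) *~ c t.

Lemma bdry_is_zmod_morphism (k l : nat) : zmod_morphism (@bdry k l).
Proof.
move=> c c'; rewrite /bdry -sumrB; apply: eq_bigr => t _.
by rewrite !ffunE mulrzBr.
Qed.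
HB.instance Definition _ (k l : nat) :=
  GRing.isZmodMorphism.Build (EMC k.+1 l) (EMC k l) (@bdry k l)
    (@bdry_is_zmod_morphism k l).

(* EMC_{-1,l} = 0, so every 0-chain is a cycle. *)
Definition is_cycle (k l : nat) : EMC k l -> bool :=
  match k with
  | 0 => fun=> true
  | k'.+1 => fun c => bdry c == 0
  end.

Lemma is_cycle_zmod_closed (k l : nat) : zmod_closed (@is_cycle k l).
Proof.
case: k => [|k]; split=> // [|c c' /eqP bc /eqP bc']; apply/eqP.
  exact: raddf0.
by rewrite raddfB /= bc bc' subr0.
Qed.
HB.instance Definition _ (k l : nat) :=
  GRing.isZmodClosed.Build (EMC k l) (@is_cycle k l)
    (@is_cycle_zmod_closed k l).

Definition cycles (k l : nat) : Type := {c : EMC k l | is_cycle c}.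
HB.instance Definition _ (k l : nat) := SubChoice.on (cycles k l).
HB.instance Definition _ (k l : nat) :=
  [SubChoice_isSubZmodule of cycles k l by <:].

Definition is_boundary (k l : nat) (c : cycles k l) : bool :=
  `[< exists b : EMC k.+1 l, bdry b = val c >].

Lemma is_boundary_zmod_closed (k l : nat) : zmod_closed (@is_boundary k l).
Proof.
split=> [|c c' /asboolP[b bc] /asboolP[b' bc']]; apply/asboolP.
  by exists 0; rewrite raddf0.
by exists (b - b'); rewrite raddfB /= bc bc'.
Qed.
HB.instance Definition _ (k l : nat) :=
  GRing.isZmodClosed.Build (cycles k l) (@is_boundary k l)
    (@is_boundary_zmod_closed k l).

Definition EMH (k l : nat) : zmodType :=
  Quotient.quot (GRing.ZmodClosed.clone (cycles k l) (@is_boundary k l) _).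

Definition diagonal_EMH : Prop :=
  forall k l : nat, (exists h : EMH k l, h != 0) -> k = l.

Definition complete_graph : Prop := forall x y : V, x != y -> e x y.

(* Without connectedness, a disjoint union of nonempty complete graphs would be
   diagonal without being complete, since k-paths have finite steps. *)
Definition connected_graph : Prop := forall x y : V, gdist x y != None.

End EulerianMagnitudeHomology.

(* Main.v *)
(* In a complete graph every step has length 1, so Eulerian k-paths have length k
   and off-diagonal chain groups vanish.  In a connected non-complete graph on n
   vertices, take an ordering of all vertices of maximal length l; starting at two
   non-adjacent vertices shows l > n - 1.  All its faces vanish: if deleting a
   vertex kept the length, appending that vertex at the end would give a longer
   ordering.  It is thus a cycle, and it is not a boundary since there are no
   Eulerian n-paths; hence EMH_{n-1,l} is nonzero. *)
Require Import Defs.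
From mathcomp Require Import all_boot.
From mathcomp Require Import all_algebra boolp.

Set Implicit Arguments.
Unset Strict Implicit.
Unset Printing Implicit Defensive.

Import GRing.Theory.

Section EulerianMagnitudeHomology.
Variables (V : finType) (e : rel V).

Lemma gdist_gt0 (x y : V) (n : nat) : x != y -> gdist e x y = Some n -> 0 < n.
Proof.
case: n => // xy /gdistP[/existsP[p]].
by rewrite (tuple0 p) /= (negPf xy).
Qed.

(** A walk with no edge forces [x = y], and a walk with one edge makes [x] and [y] adjacent. *)
Lemma gdist_gt1 (x y : V) (n : nat) :
  x != y -> ~~ e x y -> gdist e x y = Some n -> 1 < n.
Proof.
move=> xy nexy xyn; have := gdist_gt0 xy xyn.
case: n xyn => [|[|//]] // /gdistP[/existsP[p /andP[]]].
case/tupleP: p => z p; rewrite (tuple0 p) /= andbT => exz /eqP zy.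
by rewrite -zy exz in nexy.
Qed.

Lemma gdist_adj (x y : V) : x != y -> e x y -> gdist e x y = Some 1.
Proof.
move=> xy exy; apply/gdistP; split.
  by apply/existsP; exists [tuple y]; rewrite /= exy eqxx.
case=> // /existsP[p]; by rewrite (tuple0 p) /= (negPf xy).
Qed.

Lemma uniq_step_neq (k : nat) (t : k.+1.-tuple V) (i : 'I_k) :
  uniq t -> tnth t (widen_ord (leqnSn k) i) != tnth t (lift ord0 i).
Proof.
(* Equal consecutive entries would identify the indices [i] and [i + 1]. *)
move=> /tuple_uniqP t_inj; apply/eqP => /t_inj /(congr1 val) /=.
by rewrite /bump /= add1n => /eqP; rewrite ltn_eqF.
Qed.

Lemma uniq_size_leq_card (n : nat) (t : n.-tuple V) : uniq t -> n <= #|V|.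
Proof. by move=> /card_uniqP; rewrite size_tuple => <-; apply: max_card. Qed.

Lemma complete_kpath_length (k : nat) (t : k.+1.-tuple V) :
  complete_graph e -> uniq t -> kpath_length e t = k.
Proof.
move=> e_complete t_uniq; rewrite /kpath_length -[RHS]card_ord -sum1_card.
apply: eq_bigr => i _; have neq := uniq_step_neq i t_uniq.
by rewrite (gdist_adj neq (e_complete _ _ neq)).
Qed.

Section Connected.
Hypothesis e_conn : connected_graph e.

Lemma uniq_eulerian (k : nat) (t : k.+1.-tuple V) :
  uniq t -> is_eulerian e (kpath_length e t) t.
Proof.
move=> t_uniq; rewrite /is_eulerian t_uniq eqxx !andbT.
by apply/forallP => i /=; rewrite uniq_step_neq //= e_conn.
Qed.

Lemma odflt_gdist_gt0 (x y : V) : x != y -> 0 < odflt 0 (gdist e x y).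
Proof.
(* Connectedness excludes the default value 0 of [odflt]. *)
move=> xy; have := e_conn x y; case E: (gdist e x y) => [n|//] _ /=.
exact: gdist_gt0 E.
Qed.

Lemma ltn_kpath_length (k : nat) (t : k.+2.-tuple V) :
  uniq t -> ~~ e (tnth t ord0) (tnth t (lift ord0 ord0)) ->
  k.+1 < kpath_length e t.
Proof.
move=> t_uniq nadj; rewrite /kpath_length big_ord_recl.
have neq := uniq_step_neq (ord0 : 'I_k.+1) t_uniq.
have w0 : widen_ord (leqnSn k.+1) ord0 = ord0 by apply: val_inj.
(* The non-adjacent first step contributes at least 2, each of the other [k] steps at least 1. *)
rewrite w0 in neq *; rewrite -[k.+2]/(2 + k); apply: leq_add.
  have := e_conn (tnth t ord0) (tnth t (lift ord0 ord0)).
  by case E: gdist => [n|//] _ /=; apply: gdist_gt1 E.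
rewrite -[X in X <= _]card_ord -sum1_card; apply: leq_sum => i _.
exact/odflt_gdist_gt0/uniq_step_neq.
Qed.

(** The old steps keep their lengths, and the new last step joins two distinct vertices, so it adds
    at least 1. *)
Lemma kpath_length_rcons (k : nat) (t : k.+1.-tuple V) (x : V) :
  x \notin t -> kpath_length e t < kpath_length e [tuple of rcons t x].
Proof.
move=> xt; rewrite /kpath_length big_ord_recr /= -addn1; apply: leq_add.
  apply/eq_leq/eq_bigr => i _; congr (odflt 0 (gdist e _ _)).
    by rewrite !(tnth_nth x) /= nth_rcons size_tuple ltnS ltnW.
  by rewrite !(tnth_nth x) /= nth_rcons size_tuple /bump /= add1n ltnS ltn_ord.
apply: odflt_gdist_gt0.
rewrite !(tnth_nth x) /= !nth_rcons size_tuple /bump /= add1n ltnSn ltnn eqxx.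
by apply: contraNneq xt => <-; rewrite mem_nth // size_tuple.
Qed.

Lemma del_rcons_uniq (k : nat) (t : k.+2.-tuple V) (i : 'I_k.+2) :
  uniq t -> uniq (rcons (del i t) (tnth t i)).
Proof.
move=> /tuple_uniqP t_inj; rewrite rcons_uniq; apply/andP; split.
  apply/tnthP => -[j]; rewrite tnth_mktuple => /t_inj /eqP.
  by rewrite (negPf (neq_lift i j)).
apply/tuple_uniqP => j j'; rewrite !tnth_mktuple => /t_inj; exact: lift_inj.
Qed.

Lemma face_longest_eq0 (k l : nat) (i : 'I_k.+2) (t : epath e k.+1 l) :
    (forall s : k.+2.-tuple V, uniq s -> kpath_length e s <= l) ->
  face i t = 0%R.
Proof.
case: t => t /= t_eul; have /and3P[_ t_uniq _] := t_eul.
move=> longest; rewrite /face; case: insubP => //= s /and3P[_ _ /eqP del_l] _.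
have s_uniq := del_rcons_uniq i t_uniq.
(* Moving the deleted vertex to the end restores the number of entries, so the maximality of [l]
   applies. *)
have := longest [tuple of rcons (del i t) (tnth t i)] s_uniq.
move: s_uniq; rewrite rcons_uniq => /andP[/kpath_length_rcons + _].
by rewrite del_l ltnNge => /negPf ->.
Qed.

End Connected.

Lemma bdry_gen (k l : nat) (t : epath e k.+1 l) :
  bdry (EMC_gen t) =
    (\sum_(i < k.+2 | (0 < i < k.+1)%N) face i t *~ ((-1) ^+ i))%R.
Proof.
rewrite /bdry (bigD1 t) //= ffunE eqxx mulr1z [X in (_ + X)%R]big1 ?addr0 // => s st.
by rewrite ffunE (negPf st) mulr0z.
Qed.

(** A generator would have [k.+2] distinct entries, more than there are vertices, so the sum is
    empty. *)
Lemma bdry_above_card (k l : nat) (b : EMC e k.+1 l) :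
  #|V| <= k.+1 -> bdry b = 0%R.
Proof.
move=> card_le; rewrite /bdry big1 // => -[t t_eul] _.
have /and3P[_ /uniq_size_leq_card t_le _] := t_eul.
by have := leq_trans t_le card_le; rewrite ltnn.
Qed.

Lemma EMH_neq0 (k l : nat) (c : cycles e k l) :
  ~ (exists b : EMC e k.+1 l, bdry b = val c) -> exists h : EMH e k l, h != 0%R.
Proof.
move=> c_nbd; exists (\pi_(EMH e k l) c)%qT.
have -> : (0 : EMH e k l)%R = (\pi_(EMH e k l) 0%R)%qT by rewrite pi_zeror.
(* Two classes agree exactly when the difference of their representatives is a boundary. *)
by rewrite -Quotient.idealrBE subr0; apply/negP => /asboolP.
Qed.

Lemma EMH_eq0 (k l : nat) (h : EMH e k l) :
  (forall t : k.+1.-tuple V, ~~ is_eulerian e l t) -> h = 0%R.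
Proof.
(* Representatives of [h] and 0 are functions on an empty set of generators, hence equal. *)
move=> no_eul; rewrite -[h]reprK -[RHS]reprK; congr (\pi_(EMH e k l) _)%qT.
by apply/val_inj/ffunP => -[t t_eul]; case/negP: (no_eul t).
Qed.

Lemma longest_EMH_neq0 (k : nat) (t : k.+2.-tuple V) :
    connected_graph e -> #|V| = k.+2 -> uniq t ->
    (forall s : k.+2.-tuple V, uniq s -> kpath_length e s <= kpath_length e t) ->
  exists h : EMH e k.+1 (kpath_length e t), h != 0%R.
Proof.
move=> e_conn cardV t_uniq longest.
pose p : epath e k.+1 (kpath_length e t) := Sub t (uniq_eulerian e_conn t_uniq).
have p_cycle : is_cycle (EMC_gen p).
  apply/eqP; rewrite bdry_gen big1 // => i _.
  by rewrite (face_longest_eq0 e_conn) // mul0rz.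
apply: (@EMH_neq0 _ _ (Sub (EMC_gen p) p_cycle)) => -[b].
(* Every boundary here is 0, while the generator takes the value 1 at [p]. *)
rewrite bdry_above_card ?cardV // SubK => /ffunP/(_ p).
by rewrite !ffunE eqxx.
Qed.

Lemma uniq_tuple_extending (x y : V) (k : nat) :
  x != y -> #|V| = k.+2 ->
  exists2 t : k.+2.-tuple V, uniq t &
    tnth t ord0 = x /\ tnth t (lift ord0 ord0) = y.
Proof.
move=> xy cardV; pose s := [:: x, y & enum (predC (pred2 x y))].
have s_size : size s == k.+2.
  rewrite /= -cardE -[in k.+2]cardV -(cardC (pred2 x y)) card2 xy.
  by rewrite add2n.
exists (Tuple s_size); last by rewrite !(tnth_nth x).
by rewrite /= !inE !mem_enum !inE !eqxx (negPf xy) orbT enum_uniq.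
Qed.

Lemma diagonal_complete :
  connected_graph e -> diagonal_EMH e -> complete_graph e.
Proof.
move=> e_conn diag x y xy; apply/negPn/negP => nadj.
(* The distinct pair [x], [y] rules out fewer than two vertices. *)
case cardV: #|V| (uniq_size_leq_card (t := [tuple x; y])) => [|[|k]] V_ge2.
- by rewrite /= inE xy in V_ge2; have := V_ge2 isT.
- by rewrite /= inE xy in V_ge2; have := V_ge2 isT.
have [t0 t0_uniq [t0x t0y]] := uniq_tuple_extending xy cardV.
have t0_long : k.+1 < kpath_length e t0 by rewrite ltn_kpath_length ?t0x ?t0y.
case: (@arg_maxnP _ t0 (fun t : k.+2.-tuple V => uniq t) (@kpath_length V e k.+1)
  t0_uniq) => t t_uniq longest.
(* Diagonality forces [t] to have length [k.+1], yet [t] is at least as long as [t0]. *)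
have := diag _ _ (longest_EMH_neq0 e_conn cardV t_uniq longest).
by move=> k_eq; have := leq_trans t0_long (longest t0 t0_uniq); rewrite -k_eq ltnn.
Qed.

Lemma complete_diagonal : complete_graph e -> diagonal_EMH e.
Proof.
move=> e_complete k l [h h_neq0]; apply/eqP; apply: contraNT h_neq0 => neq.
apply/eqP/EMH_eq0 => t; apply/negP => /and3P[_ t_uniq].
by rewrite complete_kpath_length // (negPf neq).
Qed.

End EulerianMagnitudeHomology.

Theorem corollary7p14 (V : finType) (e : rel V)
  (e_sym : symmetric e) (e_irr : irreflexive e)
  (e_conn : connected_graph e) :
  diagonal_EMH e <-> complete_graph e.
Proof.
split; [exact: diagonal_complete | exact: complete_diagonal].
Qed.
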